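(* Let $0<q<1$, let $a\in\mathbb{C}$ with $aq^k\ne1$ for all integers $k\ge1$, and let $m\ge0$ be an integer. Then $$\sum_{n=-\infty}^\infty\frac{q^{n^2+mn}}{(aq;q)_n}=(-1)^mq^{-\binom m2}\left[c_m(a,q)\sum_{n=-\infty}^\infty\frac{q^{n^2}}{(aq;q)_n}-d_m(a,q)\sum_{n=-\infty}^\infty\frac{q^{n^2+n}}{(aq;q)_n}\right].$$
   Context: For $n\ge0$, $(x;q)_n=\prod_{j=0}^{n-1}(1-xq^j)$, and for $n>0$, $1/(x;q)_{-n}=\prod_{j=1}^{n}(1-xq^{-j})$; thus $1/(aq;q)_{-n}=\prod_{j=0}^{n-1}(1-aq^{-j})$. The polynomials $c_m(a,q)$ and $d_m(a,q)$, $m\ge0$, are the two solutions of the recurrence $$y_{m+1}=q^{m-1}y_{m-1}+a\,y_m,\qquad m\ge1,$$ with initial conditions $c_0(a,q)=1$, $c_1(a,q)=0$ and $d_0(a,q)=0$, $d_1(a,q)=1$. *)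

(* Defs.v *)
From Stdlib Require Import Reals ZArith.
From Coquelicot Require Import Coquelicot.

Open Scope C_scope.

(* (x;q)_n = prod_{j=0}^{n-1} (1 - x q^j), for n >= 0 *)
Fixpoint qpoch (x q : C) (n : nat) : C :=
  match n with
  | O => 1
  | S k => qpoch x q k * (1 - x * q ^ k)
  end.

(* prod_{j=1}^{n} (1 - x q^{-j}) *)
Fixpoint qprod_neg (x q : C) (n : nat) : C :=
  match n with
  | O => 1
  | S k => qprod_neg x q k * (1 - x / q ^ (S k))
  end.

(* 1/(x;q)_n for an integer n.  For n < 0 the reciprocal itself is the finite
   product, which may vanish, so it is not defined by inverting (x;q)_n. *)
Definition inv_qpoch (x q : C) (n : Z) : C :=
  if Z.leb 0 n then / qpoch x q (Z.to_nat n)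
  else qprod_neg x q (Z.to_nat (- n)).

(* The solution of y_{m+1} = q^{m-1} y_{m-1} + a y_m, m >= 1, with given y_0 and
   y_1; in the recursive clause the new index is m+1 = j+2, so q^{m-1} = q^j. *)
Fixpoint rec_sol (y0 y1 a q : C) (m : nat) : C :=
  match m with
  | O => y0
  | S k =>
      match k with
      | O => y1
      | S j => q ^ j * rec_sol y0 y1 a q j + a * rec_sol y0 y1 a q k
      end
  end.

Definition c_poly (m : nat) (a q : C) : C := rec_sol 1 0 a q m.
Definition d_poly (m : nat) (a q : C) : C := rec_sol 0 1 a q m.

(* sum_{n in Z} f n = l, with the sums over n >= 0 and over n < 0 both
   convergent; the latter is indexed by k with n = -(k+1). *)
Definition is_bilateral_series (f : Z -> C) (l : C) : Prop :=
  exists lpos lneg : C,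
    is_series (fun k : nat => f (Z.of_nat k)) lpos /\
    is_series (fun k : nat => f (- Z.of_nat (S k))%Z) lneg /\
    l = lpos + lneg.

(* binomial coefficient (m choose 2); the division is exact *)
Definition binom2 (m : nat) : nat := (m * (m - 1) / 2)%nat.

(* Main.v *)
Require Import Defs.
From Stdlib Require Import Reals ZArith Lra Lia.
From Coquelicot Require Import Coquelicot.

(** Write [S_m] for the bilateral sum with general term
    [t_m(n) = q^(n^2+mn) / (aq;q)_n].  For every integer [n], negative or not,
    [1/(aq;q)_n = (1 - a q^(n+1)) / (aq;q)_(n+1)].  Multiplying this by
    [q^((n+1)^2 + m(n+1))] and completing the exponent gives the contiguity
    relation [t_m(n+1) - a t_(m+1)(n+1) = q^(m+1) t_(m+2)(n)]
    ([theta_term_contiguous]).  A bilateral sum does not change when its index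
    is translated, so the relation sums to
    [S_m - a S_(m+1) = q^(m+1) S_(m+2)].  After the renormalisation
    [S_m = (-1)^m q^(-binom(m,2)) T_m] this is exactly the recurrence
    [T_(m+2) = q^m T_m + a T_(m+1)], and [T_0 = S_0], [T_1 = - S_1], whence
    [T_m = c_m S_0 - d_m S_1].

    Convergence has to be established only for [m = 0] and [m = 1]; the
    contiguity relation carries it to all other [m].  In both directions the
    ratio of consecutive terms is [O(q^k)]: for [n -> +oo] it is
    [q^(2n+m+1) / (1 - a q^(n+1))], and for [n = -k -> -oo] the factor
    [1 - a q^(-k)] grows like [q^(-k)] but is beaten by [q^(2k)].
    Completeness of the complex numbers enters through real and imaginary
    parts. *)

Open Scope C_scope.

(** * Convergent complex series *)

Lemma is_series_Re_Im (u : nat -> C) (x y : R) :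
  is_series (fun k => Re (u k)) x -> is_series (fun k => Im (u k)) y ->
  is_series u ((x, y) : C).
Proof.
  intros hx hy.
  apply filterlim_locally; intros eps.
  pose proof (proj1 (filterlim_locally _ _) hx eps) as ex.
  pose proof (proj1 (filterlim_locally _ _) hy eps) as ey.
  generalize (filter_and _ _ ex ey); apply filter_imp; intros n [bx by_].
  assert (E : sum_n (G := C_NormedModule) u n =
    (sum_n (fun k => Re (u k)) n, sum_n (fun k => Im (u k)) n)).
  { clear; induction n as [|n IH].
    - rewrite !sum_O; apply surjective_pairing.
    - rewrite !sum_Sn, IH; reflexivity. }
  rewrite E; split; assumption.
Qed.

Lemma ex_series_C_le (u : nat -> C) (b : nat -> R) :
  (forall k, (Cmod (u k) <= b k)%R) -> ex_series b -> ex_series u.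
Proof.
  intros hu hb.
  assert (hre : ex_series (fun k => Re (u k))).
  { apply (ex_series_le (V := R_CompleteNormedModule)) with b; [|exact hb]; intros k.
    apply Rle_trans with (2 := hu k).
    eapply Rle_trans; [apply Rmax_l | apply Rmax_Cmod]. }
  assert (him : ex_series (fun k => Im (u k))).
  { apply (ex_series_le (V := R_CompleteNormedModule)) with b; [|exact hb]; intros k.
    apply Rle_trans with (2 := hu k).
    eapply Rle_trans; [apply Rmax_r | apply Rmax_Cmod]. }
  destruct hre as [x hx], him as [y hy].
  exists ((x, y) : C); apply is_series_Re_Im; assumption.
Qed.

(** The ratio test in multiplicative form: all terms vanish from some point on
    the negative side when [a] is a nonnegative power of [q], so quotients of
    consecutive terms would not be usable. *)
Lemma ex_series_geometric_ratio (u : nat -> C) (q K : R) (N : nat) :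
  (0 < q < 1)%R ->
  (forall k, (N <= k)%nat -> (Cmod (u (S k)) <= K * q ^ k * Cmod (u k))%R) ->
  ex_series u.
Proof.
  intros hq hu.
  pose proof (Rabs_pos K) as hK.
  destruct (pow_lt_1_zero q) with (y := (/ (2 * (Rabs K + 1)))%R) as [M hM].
  { rewrite Rabs_pos_eq; lra. }
  { apply Rinv_0_lt_compat; lra. }
  assert (half : forall k, (N + M <= k)%nat -> (Cmod (u (S k)) <= / 2 * Cmod (u k))%R).
  { intros k hk.
    apply Rle_trans with (1 := hu k ltac:(lia)).
    apply Rmult_le_compat_r; [apply Cmod_ge_0|].
    specialize (hM k ltac:(lia)).
    assert (0 < q ^ k)%R as hqk by (apply pow_lt; lra).
    rewrite Rabs_pos_eq in hM by lra.
    assert ((Rabs K + 1) * q ^ k < / 2)%R.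
    { replace (/ 2)%R with ((Rabs K + 1) * / (2 * (Rabs K + 1)))%R by (field; lra).
      apply Rmult_lt_compat_l; lra. }
    pose proof (Rle_abs K); nra. }
  apply (ex_series_incr_n u (N + M)).
  apply ex_series_C_le with (fun k => (Cmod (u (N + M)%nat) * (/ 2) ^ k)%R).
  - induction k as [|k IH].
    + rewrite Nat.add_0_r; simpl; lra.
    + rewrite Nat.add_succ_r.
      apply Rle_trans with (1 := half (N + M + k)%nat ltac:(lia)).
      simpl; lra.
  - apply (ex_series_scal (V := R_NormedModule)), ex_series_geom.
    rewrite Rabs_pos_eq; lra.
Qed.

(** * Bilateral series *)

Lemma is_bilateral_series_ext (f g : Z -> C) (l : C) :
  (forall n, f n = g n) -> is_bilateral_series f l -> is_bilateral_series g l.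
Proof.
  intros e (p & r & hp & hr & ->).
  exists p, r; split; [|split; [|reflexivity]].
  - eapply is_series_ext; [|exact hp]; intros k; apply e.
  - eapply is_series_ext; [|exact hr]; intros k; apply e.
Qed.

Lemma is_bilateral_series_scal (c : C) (f : Z -> C) (l : C) :
  is_bilateral_series f l -> is_bilateral_series (fun n => c * f n) (c * l).
Proof.
  intros (p & r & hp & hr & ->).
  exists (c * p), (c * r); split; [|split].
  - exact (is_series_scal c _ _ hp).
  - exact (is_series_scal c _ _ hr).
  - ring.
Qed.

Lemma is_bilateral_series_plus (f g : Z -> C) (l l' : C) :
  is_bilateral_series f l -> is_bilateral_series g l' ->
  is_bilateral_series (fun n => f n + g n) (l + l').
Proof.
  intros (p & r & hp & hr & ->) (p' & r' & hp' & hr' & ->).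
  exists (p + p'), (r + r'); split; [|split].
  - exact (is_series_plus _ _ _ _ hp hp').
  - exact (is_series_plus _ _ _ _ hr hr').
  - ring.
Qed.

(** Translation moves the term at [0] from the nonnegative half of the sum to
    the negative half. *)
Lemma is_bilateral_series_shift (f : Z -> C) (l : C) :
  is_bilateral_series f l -> is_bilateral_series (fun n => f (n + 1)%Z) l.
Proof.
  intros (p & r & hp & hr & ->).
  exists (p - f 0%Z), (r + f 0%Z); split; [|split].
  - apply is_series_ext with (fun k => f (Z.of_nat (S k))).
    { intros k; f_equal; lia. }
    apply (is_series_incr_1 (fun k => f (Z.of_nat k))).
    apply (eq_ind p (is_series (fun k => f (Z.of_nat k))) hp).
    change (p = p - f 0%Z + f 0%Z); ring.
  - apply is_series_ext with (fun k => f (- Z.of_nat k)%Z).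
    { intros k; f_equal; lia. }
    apply is_series_decr_1.
    apply (eq_ind r (is_series (fun k => f (- Z.of_nat (S k))%Z)) hr).
    change (r = r + f 0%Z + - f 0%Z); ring.
  - ring.
Qed.

(** * The terms of the bilateral sums *)

Lemma RtoC_powerRZ_add (q : R) (n m : Z) :
  q <> 0%R -> RtoC (powerRZ q (n + m)) = RtoC (powerRZ q n) * RtoC (powerRZ q m).
Proof. intros h; rewrite powerRZ_add by exact h; apply RtoC_mult. Qed.

Lemma qpoch_neq_0 (x q : C) (n : nat) :
  (forall k, x * q ^ k <> 1) -> qpoch x q n <> 0.
Proof.
  intros hx; induction n as [|n IH]; simpl.
  - exact C1_nz.
  - apply Cmult_neq_0; [exact IH|].
    apply Cminus_eq_contra, not_eq_sym, hx.
Qed.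

(** [(x;q)_(n+1) = (x;q)_n (1 - x q^n)] holds on both sides of [n = 0].  The
    reciprocal form is the one that survives when some [1 - x q^n] with
    [n < 0] vanishes. *)
Lemma inv_qpoch_step (x : C) (q : R) (n : Z) :
  q <> 0%R -> (forall k : nat, x * RtoC q ^ k <> 1) ->
  inv_qpoch x (RtoC q) n =
  inv_qpoch x (RtoC q) (n + 1) * (1 - x * RtoC (powerRZ q n)).
Proof.
  intros hq hx; unfold inv_qpoch.
  destruct (Z.leb_spec 0 n) as [h|h].
  - destruct (Z.leb_spec 0 (n + 1)) as [_|h']; [|lia].
    replace (Z.to_nat (n + 1)) with (S (Z.to_nat n)) by lia.
    replace (powerRZ q n) with (q ^ Z.to_nat n)%R
      by (rewrite pow_powerRZ; f_equal; lia).
    rewrite RtoC_pow; simpl; field; split.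
    + apply Cminus_eq_contra, not_eq_sym, hx.
    + apply qpoch_neq_0, hx.
  - destruct (Z.to_nat (- n)) as [|k] eqn:E; [lia|].
    replace n with (- Z.of_nat (S k))%Z by lia.
    rewrite powerRZ_neg', <- pow_powerRZ, RtoC_inv, RtoC_pow
      by (apply pow_nonzero, hq).
    replace (- Z.of_nat (S k) + 1)%Z with (- Z.of_nat k)%Z by lia.
    rewrite Z.opp_involutive, Nat2Z.id.
    destruct k as [|k].
    + simpl; unfold Cdiv; field.
      intros h0; apply hq, RtoC_inj, h0.
    + reflexivity.
Qed.

Section ThetaTerm.

Variables (q : R) (a : C).
Hypothesis hq : (0 < q < 1)%R.
Hypothesis ha : forall k : nat, (1 <= k)%nat -> a * RtoC q ^ k <> 1.

Definition theta_term (m n : Z) : C :=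
  RtoC (powerRZ q (n ^ 2 + m * n)) * inv_qpoch (a * RtoC q) (RtoC q) n.

Lemma inv_qpoch_shifted_step (n : Z) :
  inv_qpoch (a * RtoC q) (RtoC q) n =
  inv_qpoch (a * RtoC q) (RtoC q) (n + 1) * (1 - a * RtoC (powerRZ q (n + 1))).
Proof.
  assert (q <> 0)%R as hq0 by lra.
  rewrite inv_qpoch_step; [|exact hq0|].
  - rewrite (Z.add_comm n 1), RtoC_powerRZ_add, powerRZ_1 by exact hq0; ring.
  - intros k; rewrite <- Cmult_assoc, <- Cpow_S; apply ha; lia.
Qed.

Lemma theta_term_step (m n : Z) :
  theta_term m (n + 1) * (1 - a * RtoC (powerRZ q (n + 1))) =
  RtoC (powerRZ q (2 * n + 1 + m)) * theta_term m n.
Proof.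
  unfold theta_term; rewrite (inv_qpoch_shifted_step n).
  replace ((n + 1) ^ 2 + m * (n + 1))%Z
    with ((2 * n + 1 + m) + (n ^ 2 + m * n))%Z by ring.
  rewrite (RtoC_powerRZ_add q (2 * n + 1 + m)) by lra; ring.
Qed.

Lemma theta_term_contiguous (m n : Z) :
  theta_term m (n + 1) - a * theta_term (m + 1) (n + 1) =
  RtoC (powerRZ q (m + 1)) * theta_term (m + 2) n.
Proof.
  unfold theta_term; rewrite (inv_qpoch_shifted_step n).
  replace ((n + 1) ^ 2 + (m + 1) * (n + 1))%Z
    with ((m + 1) + (n ^ 2 + (m + 2) * n) + (n + 1))%Z by ring.
  replace ((n + 1) ^ 2 + m * (n + 1))%Z
    with ((m + 1) + (n ^ 2 + (m + 2) * n))%Z by ring.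
  rewrite !RtoC_powerRZ_add by lra; ring.
Qed.

Lemma Cmod_RtoC_powerRZ (z : Z) : Cmod (RtoC (powerRZ q z)) = powerRZ q z.
Proof. rewrite Cmod_R; apply Rabs_pos_eq, powerRZ_le; lra. Qed.

Lemma pow_le_1 (k : nat) : (0 < q ^ k <= 1)%R.
Proof.
  split; [apply pow_lt; lra|].
  rewrite <- (pow1 k); apply pow_incr; lra.
Qed.

Lemma ex_series_theta_term_nonneg (m : Z) :
  ex_series (fun k : nat => theta_term m (Z.of_nat k)).
Proof.
  pose proof (Cmod_ge_0 a) as ha0.
  destruct (pow_lt_1_zero q) with (y := (/ (2 * (Cmod a + 1)))%R) as [N hN].
  { rewrite Rabs_pos_eq; lra. }
  { apply Rinv_0_lt_compat; lra. }
  (* From [N] on, [|a| q^(k+1) <= 1/2], hence [|1 - a q^(k+1)| >= 1/2]; this is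
     the source of the factor [2]. *)
  apply ex_series_geometric_ratio with (q := q) (K := (2 * powerRZ q (m + 1))%R) (N := N);
    [exact hq|]; intros k hk.
  pose proof (f_equal Cmod (theta_term_step m (Z.of_nat k))) as e.
  rewrite !Cmod_mult, Cmod_RtoC_powerRZ in e.
  replace (Z.of_nat k + 1)%Z with (Z.of_nat (S k)) in e by lia.
  replace (2 * Z.of_nat k + 1 + m)%Z
    with ((m + 1) + (Z.of_nat k + Z.of_nat k))%Z in e by ring.
  rewrite !powerRZ_add, <- !pow_powerRZ in e by lra.
  assert (hd : (/ 2 <= Cmod (1 - a * RtoC (q ^ S k)))%R).
  { specialize (hN (S k) ltac:(lia)).
    pose proof (pow_le_1 (S k)) as hqk.
    rewrite Rabs_pos_eq in hN by lra.
    assert (hs : ((Cmod a + 1) * q ^ S k < / 2)%R).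
    { replace (/ 2)%R with ((Cmod a + 1) * / (2 * (Cmod a + 1)))%R by (field; lra).
      apply Rmult_lt_compat_l; lra. }
    pose proof (Cmod_triangle (1 - a * RtoC (q ^ S k)) (a * RtoC (q ^ S k))) as ht.
    replace (1 - a * RtoC (q ^ S k) + a * RtoC (q ^ S k)) with (RtoC 1) in ht by ring.
    rewrite Cmod_1, Cmod_mult, Cmod_R, (Rabs_pos_eq (q ^ S k)) in ht by lra.
    lra. }
  set (t := Cmod (theta_term m (Z.of_nat k))) in *.
  set (t' := Cmod (theta_term m (Z.of_nat (S k)))) in *.
  assert (0 <= t)%R by apply Cmod_ge_0.
  assert (0 <= t')%R by apply Cmod_ge_0.
  assert (ht' : (/ 2 * t' <= powerRZ q (m + 1) * (q ^ k * q ^ k) * t)%R).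
  { rewrite powerRZ_add by lra; rewrite <- e.
    rewrite (Rmult_comm (/ 2)); apply Rmult_le_compat_l; assumption. }
  assert (hb : (powerRZ q (m + 1) * (q ^ k * q ^ k) * t
                <= powerRZ q (m + 1) * q ^ k * t)%R).
  { apply Rmult_le_compat_r; [assumption|].
    apply Rmult_le_compat_l; [apply powerRZ_le; lra|].
    pose proof (pow_le_1 k); nra. }
  lra.
Qed.

Lemma ex_series_theta_term_neg (m : Z) :
  ex_series (fun k : nat => theta_term m (- Z.of_nat (S k))%Z).
Proof.
  apply ex_series_geometric_ratio
    with (q := q) (K := (powerRZ q (2 - m) * (1 + Cmod a))%R) (N := 0%nat);
    [exact hq|]; intros k _.
  pose proof (theta_term_step m (- Z.of_nat (S (S k)))) as e.
  replace (- Z.of_nat (S (S k)) + 1)%Z with (- Z.of_nat (S k))%Z in e by lia.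
  set (j := S k) in *.
  (* The growth of [1 - a q^(-j)] takes only one of the two factors [q^j]. *)
  assert (E : theta_term m (- Z.of_nat (S j)) =
    RtoC (powerRZ q (1 - m)) * RtoC (q ^ j)
      * (RtoC (q ^ j) - a) * theta_term m (- Z.of_nat j)).
  { rewrite !pow_powerRZ.
    transitivity (RtoC (powerRZ q ((1 - m) + (Z.of_nat j + Z.of_nat j)))
      * (RtoC (powerRZ q (2 * - Z.of_nat (S j) + 1 + m))
         * theta_term m (- Z.of_nat (S j)))).
    - rewrite Cmult_assoc, <- RtoC_powerRZ_add by lra.
      replace ((1 - m) + (Z.of_nat j + Z.of_nat j)
        + (2 * - Z.of_nat (S j) + 1 + m))%Z with 0%Z by lia.
      simpl powerRZ; ring.
    - rewrite <- e.
      rewrite !(RtoC_powerRZ_add q (1 - m)), !(RtoC_powerRZ_add q (Z.of_nat j)) by lra.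
      assert (hj : RtoC (powerRZ q (Z.of_nat j)) * RtoC (powerRZ q (- Z.of_nat j)) = 1).
      { rewrite <- RtoC_powerRZ_add by lra.
        replace (Z.of_nat j + - Z.of_nat j)%Z with 0%Z by lia; reflexivity. }
      set (X := RtoC (powerRZ q (Z.of_nat j))) in *.
      set (Y := RtoC (powerRZ q (- Z.of_nat j))) in *.
      replace (X - a) with (X - a * (X * Y)) by (rewrite hj; ring).
      ring. }
  rewrite E, !Cmod_mult, Cmod_RtoC_powerRZ.
  apply Rmult_le_compat_r; [apply Cmod_ge_0|].
  pose proof (pow_le_1 j) as hj.
  rewrite Cmod_R, (Rabs_pos_eq (q ^ j)) by lra.
  replace (2 - m)%Z with ((1 - m) + 1)%Z by ring.
  rewrite powerRZ_add, powerRZ_1 by lra.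
  replace (q ^ j)%R with (q * q ^ k)%R by reflexivity.
  assert (hc : (Cmod (RtoC (q ^ j) - a) <= 1 + Cmod a)%R).
  { eapply Rle_trans; [apply Cmod_triangle|].
    rewrite Cmod_opp, Cmod_R, Rabs_pos_eq; lra. }
  assert (0 <= powerRZ q (1 - m) * (q * q ^ k))%R.
  { apply Rmult_le_pos; [apply powerRZ_le; lra|].
    change (0 <= q ^ j)%R; lra. }
  apply Rle_trans with (powerRZ q (1 - m) * (q * q ^ k) * (1 + Cmod a))%R; [|lra].
  apply Rmult_le_compat_l; assumption.
Qed.

Lemma ex_bilateral_theta_term (m : Z) :
  exists l, is_bilateral_series (theta_term m) l.
Proof.
  destruct (ex_series_theta_term_nonneg m) as [p hp].
  destruct (ex_series_theta_term_neg m) as [r hr].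
  exists (p + r), p, r; auto.
Qed.

(** * The three-term recurrence *)

Lemma is_bilateral_theta_term_contiguous (m : Z) (l l' : C) :
  is_bilateral_series (theta_term m) l ->
  is_bilateral_series (theta_term (m + 1)) l' ->
  is_bilateral_series (theta_term (m + 2))
    (RtoC (powerRZ q (- (m + 1))) * (l + - a * l')).
Proof.
  intros h h'.
  apply is_bilateral_series_ext
    with (fun n => RtoC (powerRZ q (- (m + 1)))
            * (theta_term m (n + 1) + - a * theta_term (m + 1) (n + 1))).
  - intros n.
    replace (theta_term m (n + 1) + - a * theta_term (m + 1) (n + 1))
      with (theta_term m (n + 1) - a * theta_term (m + 1) (n + 1)) by ring.
    rewrite theta_term_contiguous, Cmult_assoc, <- RtoC_powerRZ_add by lra.
    rewrite Z.add_opp_diag_l; simpl powerRZ; ring.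
  - apply is_bilateral_series_scal.
    apply (is_bilateral_series_shift
             (fun n => theta_term m n + - a * theta_term (m + 1) n)).
    apply is_bilateral_series_plus; [exact h|].
    apply is_bilateral_series_scal, h'.
Qed.

End ThetaTerm.

Lemma binom2_succ (m : nat) : binom2 (S m) = (binom2 m + m)%nat.
Proof.
  unfold binom2.
  replace (S m * (S m - 1))%nat with (m * (m - 1) + m * 2)%nat by (destruct m; simpl; nia).
  apply Nat.div_add; lia.
Qed.

(** The factor [(-1)^m q^(-binom(m,2))] turns the polynomial recurrence with
    coefficient [q^m] into the one satisfied by the bilateral sums, because
    [binom(m+2,2) - binom(m,2) = 2m + 1] and
    [binom(m+2,2) - binom(m+1,2) = m + 1]. *)
Lemma normalised_recurrence (q : R) (a u0 u1 u2 : C) (m : nat) :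
  q <> 0%R -> u2 = RtoC q ^ m * u0 + a * u1 ->
  (- (1)) ^ S (S m) * RtoC (powerRZ q (- Z.of_nat (binom2 (S (S m))))) * u2 =
  RtoC (powerRZ q (- (Z.of_nat m + 1))) *
    ((- (1)) ^ m * RtoC (powerRZ q (- Z.of_nat (binom2 m))) * u0
     + - a * ((- (1)) ^ S m * RtoC (powerRZ q (- Z.of_nat (binom2 (S m)))) * u1)).
Proof.
  intros hq ->.
  rewrite !binom2_succ.
  replace (- Z.of_nat (binom2 m + m + S m))%Z
    with (- (Z.of_nat m + 1) + (- Z.of_nat (binom2 m) + - Z.of_nat m))%Z by lia.
  replace (- Z.of_nat (binom2 m + m))%Z
    with (- Z.of_nat (binom2 m) + - Z.of_nat m)%Z by lia.
  rewrite !(RtoC_powerRZ_add q (- (Z.of_nat m + 1))),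
    !(RtoC_powerRZ_add q (- Z.of_nat (binom2 m))) by exact hq.
  assert (hm : RtoC (powerRZ q (- Z.of_nat m)) * RtoC q ^ m = 1).
  { rewrite <- RtoC_pow, pow_powerRZ, <- RtoC_powerRZ_add by exact hq.
    rewrite Z.add_opp_diag_l; reflexivity. }
  rewrite !Cpow_S.
  set (Y := RtoC (powerRZ q (- Z.of_nat m))) in *.
  set (X := RtoC q ^ m) in *.
  set (A := RtoC (powerRZ q (- (Z.of_nat m + 1)))).
  set (B := RtoC (powerRZ q (- Z.of_nat (binom2 m)))).
  set (s := (- (1)) ^ m).
  transitivity (A * (s * B * (Y * X) * u0 + a * (s * (B * Y) * u1))); [ring|].
  rewrite hm; ring.
Qed.

Theorem theorem3p3 (q : R) (a : C) (m : nat)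
    (hq : (0 < q < 1)%R)
    (ha : forall k : nat, (1 <= k)%nat -> a * RtoC q ^ k <> 1) :
  exists Sm S0 S1 : C,
    is_bilateral_series
      (fun n : Z => RtoC (powerRZ q (n ^ 2 + Z.of_nat m * n)) *
                    inv_qpoch (a * RtoC q) (RtoC q) n) Sm /\
    is_bilateral_series
      (fun n : Z => RtoC (powerRZ q (n ^ 2)) *
                    inv_qpoch (a * RtoC q) (RtoC q) n) S0 /\
    is_bilateral_series
      (fun n : Z => RtoC (powerRZ q (n ^ 2 + n)) *
                    inv_qpoch (a * RtoC q) (RtoC q) n) S1 /\
    Sm = (- (1)) ^ m * RtoC (powerRZ q (- Z.of_nat (binom2 m))) *
         (c_poly m a (RtoC q) * S0 - d_poly m a (RtoC q) * S1).
Proof.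
  destruct (ex_bilateral_theta_term q a hq ha 0) as [S0 h0].
  destruct (ex_bilateral_theta_term q a hq ha 1) as [S1 h1].
  set (T := fun k => c_poly k a (RtoC q) * S0 - d_poly k a (RtoC q) * S1).
  set (V := fun k => (- (1)) ^ k * RtoC (powerRZ q (- Z.of_nat (binom2 k))) * T k).
  assert (hV : forall k,
    is_bilateral_series (theta_term q a (Z.of_nat k)) (V k) /\
    is_bilateral_series (theta_term q a (Z.of_nat (S k))) (V (S k))).
  { induction k as [|k [IH IH']].
    - split.
      + replace (V 0%nat) with S0; [exact h0|].
        unfold V, T, c_poly, d_poly; simpl; ring.
      + replace (V 1%nat) with S1; [exact h1|].
        unfold V, T, c_poly, d_poly; simpl; ring.
    - split; [exact IH'|].
      replace (Z.of_nat (S (S k))) with (Z.of_nat k + 2)%Z by lia.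
      unfold V; rewrite (normalised_recurrence q a (T k) (T (S k)) (T (S (S k)))).
      + apply is_bilateral_theta_term_contiguous; [exact hq | exact ha | exact IH |].
        replace (Z.of_nat k + 1)%Z with (Z.of_nat (S k)) by lia; exact IH'.
      + lra.
      + unfold T, c_poly, d_poly; simpl; ring. }
  exists (V m), S0, S1; split; [exact (proj1 (hV m))|split; [|split; [|reflexivity]]].
  - eapply is_bilateral_series_ext; [|exact h0]; intros n; unfold theta_term.
    do 3 f_equal; ring.
  - eapply is_bilateral_series_ext; [|exact h1]; intros n; unfold theta_term.
    do 3 f_equal; ring.
Qed.
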